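(* Let $\mathcal V$ be a finite vocabulary, $T\ge1$, $K\ge 1$, $f:\mathcal V^T\to[K]$, $Q_{X_1^T}\in\mathcal P(\mathcal V^T)$, $\alpha\in(0,1)$ and $\epsilon\ge0$. The universally minimum $f$-robust Type-II error, i.e. the optimal value of $$\inf_{\gamma,\,P_{X_1^T,\zeta_1^T}}\beta_1(\gamma,P_{X_1^T,\zeta_1^T},f)\quad\text{s.t.}\quad\sup_{Q'\in\mathcal P(\mathcal V^T)}\beta_0(\gamma,Q',P_{\zeta_1^T},f)\le\alpha,\qquad\mathsf D_{\mathsf{TV}}(P_{X_1^T},Q_{X_1^T})\le\epsilon,$$ equals $$\beta_1^*(Q_{X_1^T},\alpha,\epsilon,f)=\min_{P_{X_1^T}:\ \mathsf D_{\mathsf{TV}}(P_{X_1^T},Q_{X_1^T})\le\epsilon}\ \sum_{k\in[K]}\Big(\Big(\sum_{x_1^T:\,f(x_1^T)=k}P_{X_1^T}(x_1^T)\Big)-\alpha\Big)_+ .$$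
   Context: Notation: $(x)_+=\max\{x,0\}$; $[K]=\{1,\dots,K\}$; $\mathcal P(\mathcal X)$ is the set of probability distributions on $\mathcal X$; $\mathsf D_{\mathsf{TV}}(\mu,\nu)=\frac12\sum_x|\mu(x)-\nu(x)|$. A watermarking scheme is a joint distribution $P_{X_1^T,\zeta_1^T}$ on $\mathcal V^T\times\mathcal Z^T$, where $\zeta_1^T$ is an auxiliary random sequence in a space $\mathcal Z^T$ (discrete or continuous; its choice is part of the design); $P_{X_1^T},P_{\zeta_1^T}$ are its marginals. A detector is a (measurable) function $\gamma:\mathcal V^T\times\mathcal Z^T\to\{0,1\}$. The infimum is over all detectors and watermarking schemes. For $x_1^T\in\mathcal V^T$ let $\mathcal B_f(x_1^T)=\{y_1^T\in\mathcal V^T: f(y_1^T)=f(x_1^T)\}$. The $f$-robust errors are $$\beta_0(\gamma,Q',P_{\zeta_1^T},f)=\mathbb E_{Q'\otimes P_{\zeta_1^T}}\Big[\sup_{\tilde x_1^T\in\mathcal B_f(X_1^T)}\mathbf 1\{\gamma(\tilde x_1^T,\zeta_1^T)=1\}\Big],$$ $$\beta_1(\gamma,P_{X_1^T,\zeta_1^T},f)=\mathbb E_{P_{X_1^T,\zeta_1^T}}\Big[\sup_{\tilde x_1^T\in\mathcal B_f(X_1^T)}\mathbf 1\{\gamma(\tilde x_1^T,\zeta_1^T)=0\}\Big].$$ *)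

(* Defs.v *)
From HB Require Import structures.
From mathcomp Require Import all_boot all_order all_algebra.
From mathcomp Require Import all_classical all_reals all_analysis.

Set Implicit Arguments.
Unset Strict Implicit.
Unset Printing Implicit Defensive.

Import Order.TTheory GRing.Theory Num.Theory.
Local Open Scope classical_set_scope.
Local Open Scope ring_scope.

(* A measurable type has to be pointed, so the vocabulary is taken nonempty;
   otherwise V^T, for T >= 1, would carry no probability distribution. *)
#[short(type="finPointedType")]
HB.structure Definition FinPointed := {V of Finite V & Pointed V}.

(* V^T, under an alias of T.-tuple V so that it carries the discrete
   sigma-algebra; a [probability (text V T) R] is an element of P(V^T). *)
Definition text (V : finPointedType) (T : nat) : Type := T.-tuple V.

HB.instance Definition _ (V : finPointedType) (T : nat) :=
  Finite.on (text V T).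
HB.instance Definition _ (V : finPointedType) (T : nat) :=
  Pointed.on (text V T).
HB.instance Definition _ (V : finPointedType) (T : nat) :=
  @isMeasurable.Build default_measure_display (text V T) discrete_measurable
    discrete_measurable0 discrete_measurableC discrete_measurableU.

HB.instance Definition _ d1 d2 (T1 : measurableType d1)
    (T2 : measurableType d2) :=
  isMeasurableFun.Build _ _ (T1 * T2)%type T1 fst measurable_fst.
HB.instance Definition _ d1 d2 (T1 : measurableType d1)
    (T2 : measurableType d2) :=
  isMeasurableFun.Build _ _ (T1 * T2)%type T2 snd measurable_snd.

Definition pmf (R : realType) (V : finPointedType) (T : nat)
  (P : probability (text V T) R) (x : text V T) : R := fine (P [set x]).

Definition tv_dist (R : realType) (V : finPointedType) (T : nat)
    (P Q : probability (text V T) R) : R :=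
  2^-1 * \sum_(x : text V T) `|pmf P x - pmf Q x|.

Section watermarking.
Context (R : realType) (V : finPointedType) (T K : nat).

(* Z^T is T.-tuple Z with the product sigma-algebra. *)
Definition scheme d (Z : measurableType d) :=
  probability (text V T * T.-tuple Z)%type R.

Definition text_law d (Z : measurableType d) (P : scheme Z) :
  probability (text V T) R := distribution P fst.

Definition aux_law d (Z : measurableType d) (P : scheme Z) :
  probability (T.-tuple Z) R := distribution P snd.

Definition detector d (Z : measurableType d) :=
  {mfun (text V T * T.-tuple Z)%type >-> bool}.

Definition fiber (f : text V T -> 'I_K) (x : text V T) : set (text V T) :=
  [set y | f y = f x].

Definition beta0 d (Z : measurableType d) (gamma : detector Z)
    (Q' : probability (text V T) R) (Pzeta : probability (T.-tuple Z) R)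
    (f : text V T -> 'I_K) : \bar R :=
  ('E_((Q' \x Pzeta)%E)[fun w : text V T * T.-tuple Z =>
    sup [set ((gamma (y, w.2) == true)%:R : R) | y in fiber f w.1]])%E.

Definition beta1 d (Z : measurableType d) (gamma : detector Z)
    (P : scheme Z) (f : text V T -> 'I_K) : \bar R :=
  ('E_P[fun w : text V T * T.-tuple Z =>
    sup [set ((gamma (y, w.2) == false)%:R : R) | y in fiber f w.1]])%E.

Definition feasible (Q : probability (text V T) R) (alpha epsilon : R)
    (f : text V T -> 'I_K) d (Z : measurableType d)
    (gamma : detector Z) (P : scheme Z) : Prop :=
  (ereal_sup [set beta0 gamma Q' (aux_law P) f
                | Q' in [set: probability (text V T) R]] <= alpha%:E)%E /\
  tv_dist (text_law P) Q <= epsilon.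

(* The space Z is part of the design, so it is quantified in the infimum. *)
Definition opt_beta1 (Q : probability (text V T) R) (alpha epsilon : R)
    (f : text V T -> 'I_K) : \bar R :=
  ereal_inf [set b | exists d (Z : measurableType d) (gamma : detector Z)
    (P : scheme Z), feasible Q alpha epsilon f gamma P /\ b = beta1 gamma P f].

Definition excess (alpha : R) (f : text V T -> 'I_K)
    (P : probability (text V T) R) : R :=
  \sum_(k < K) Num.max (\sum_(x : text V T | f x == k) pmf P x - alpha) 0.

Definition tv_ball (Q : probability (text V T) R) (epsilon : R) :
    set (probability (text V T) R) :=
  [set P | tv_dist P Q <= epsilon].

End watermarking.

(* Main.v *)
(* Converse: testing the false-alarm constraint on the point mass Q' at some x
   with f x = k bounds by alpha the P_zeta-probability that the whole fiber over
   k is accepted.  Hence the event { f X = k } contributes at least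
   (P (f X = k) - alpha)_+ to the Type-II error.

   Achievability: given the law P of X, let zeta reveal f X with the conditional
   probability min(1, alpha / P (f X = k)) on { f X = k }, and be a reserved
   symbol otherwise; the detector tests zeta = f x.  Each class symbol then has
   mass at most alpha, which bounds the false alarms for every Q'.

   The minimum over the total-variation ball exists by compactness. *)
Require Import Defs.
From HB Require Import structures.
From mathcomp Require Import all_boot all_order all_algebra.
From mathcomp Require Import all_classical all_reals all_analysis.

Set Implicit Arguments.
Unset Strict Implicit.
Unset Printing Implicit Defensive.

Import Order.TTheory GRing.Theory Num.Theory.
Import numFieldNormedType.Exports.
Local Open Scope classical_set_scope.
Local Open Scope ring_scope.

(** * Finitely supported laws and finite partitions *)

(** Used twice: for the coupling in the optimal scheme, and to turn a minimizing vector of masses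
    into a law. *)
Lemma atomic_probability d (X : measurableType d) (R : realType) (I : finType)
    (w : I -> R) (a : I -> X) :
  (forall i, 0 <= w i) -> \sum_i w i = 1 ->
  exists P : probability X R,
    forall A, P A = (\sum_i w i * \1_A (a i))%:E.
Proof.
move=> w0 w1.
(* An empty [I] would give total weight 0; [i0] only serves as the default of [nth]. *)
have [i0 _|I0] := pickP (@predT I); last first.
  by move: w1; rewrite big_pred0// => /esym/eqP; rewrite oner_eq0.
pose m := msum (fun k => mscale (NngNum (w0 (nth i0 (enum I) k)))
  (dirac (a (nth i0 (enum I) k)))) #|I|.
have mE A : m A = (\sum_i w i * \1_A (a i))%:E.
  rewrite /m /msum -sumEFin [RHS](reindex (@enum_val I predT)) /=; last first.
    exact/onW_bij/enum_val_bij.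
  by apply: eq_bigr => k _; rewrite /mscale /= diracE -enum_val_nth.
have mT : m [set: X] = 1%E.
  rewrite mE -[X in _ = X%:E]w1; congr EFin.
  by apply: eq_bigr => i _; rewrite indicT mulr1.
exists (HB.pack_for (probability X R) m
  (Measure_isProbability.Build _ _ _ m mT)).
exact: mE.
Qed.

Lemma measure_fin_preimage d (X : measurableType d) (R : realType)
    (mu : {measure set X -> \bar R}) (I : finType) (g : X -> I) (A : set X) :
  measurable A -> (forall i, measurable (g @^-1` [set i])) ->
  mu A = (\sum_i mu (A `&` g @^-1` [set i]))%E.
Proof.
move=> mA mg.
have -> : mu A =
    mu (\bigcup_(i in [set` index_enum I]) (A `&` g @^-1` [set i])).
  congr (mu _); apply/seteqP; split=> [x Ax|x [i _ []]//].
  by exists (g x) => //=; rewrite mem_index_enum.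
rewrite measure_fin_bigcup//; first by rewrite -fsbig_seq ?index_enum_uniq.
- by move=> i j _ _ [x [[_ <-] [_ <-]]].
- by move=> i _; exact: measurableI.
Qed.

(** * Mass functions on texts *)

Section text_probability.
Context (R : realType) (V : finPointedType) (T : nat).
Implicit Types P : probability (text V T) R.

Lemma pmf_ge0 P x : 0 <= Defs.pmf P x.
Proof. exact: fine_ge0. Qed.

Lemma probability_pmf P (B : {pred text V T}) :
  P [set` B] = (\sum_(x in B) Defs.pmf P x)%:E.
Proof.
rewrite (measure_fin_preimage (I := text V T) _
  (g := fun x : text V T => x : text V T))//.
rewrite [in RHS]big_mkcond -sumEFin.
apply: eq_bigr => x _; case: ifPn => xB.
  rewrite /Defs.pmf fineK ?fin_num_measure//; congr (P _).
  by apply/seteqP; split=> [y []//|y /= ->].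
rewrite -[RHS](measure0 P); congr (P _).
by apply/seteqP; split=> // y /= [yB yx]; move: xB; rewrite -yx yB.
Qed.

Lemma pmf_sum1 P : \sum_x Defs.pmf P x = 1.
Proof.
apply/EFin_inj; rewrite -(probability_pmf P predT) -(@probability_setT _ _ _ P).
by congr (P _); apply/seteqP.
Qed.

End text_probability.

(** The values are 0 or 1, so the supremum is attained. This turns the suprema in both errors into
    indicators of events. *)
Lemma sup_bool (R : realType) (I : Type) (D : set I) (b : I -> bool) :
  D !=set0 ->
  sup [set ((b y)%:R : R) | y in D] = `[< exists2 y, D y & b y >]%:R.
Proof.
move=> [y0 Dy0].
have ub : ubound [set ((b y)%:R : R) | y in D] `[< exists2 y, D y & b y >]%:R.
  move=> _ [y Dy <-]; rewrite ler_nat; case: asboolP => [_|Nb].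
    exact: leq_b1.
  by case by_ : (b y) => //; case: Nb; exists y.
apply/eqP; rewrite eq_le ge_sup//=; last by exists (b y0)%:R, y0.
case: asboolP => [[y Dy by_]|_]; last first.
  apply: (@le_trans _ _ (b y0)%:R); first exact: ler0n.
  by apply: ub_le_sup; [eexists; exact: ub|exists y0].
by apply: ub_le_sup; [eexists; exact: ub|exists y => //; rewrite by_].
Qed.

(** * Errors as probabilities of events, and the converse bound *)

Section errors.
Context (R : realType) (V : finPointedType) (T K : nat) (f : text V T -> 'I_K).
Context d (Z : measurableType d).
Implicit Types (gamma : detector V T Z) (P : scheme R V T Z).

(** The robust false-alarm event for [b = true], the robust miss event for [b = false]. *)
Definition fiber_output gamma (b : bool) : set (text V T * T.-tuple Z) :=
  [set w | exists2 y, fiber f w.1 y & gamma (y, w.2) = b].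

Lemma measurable_detector_section gamma (b : bool) (y : text V T) :
  measurable [set z | gamma (y, z) = b].
Proof.
have := measurable_xsection y (measurable_funPTI gamma (Y := [set b]) I).
by congr measurable; apply/seteqP; split=> z; rewrite /xsection /= inE.
Qed.

(** There are finitely many texts, so the event is a finite union of rectangles, one for each
    observed text and substitute in its fiber. *)
Lemma measurable_fiber_output gamma b : measurable (fiber_output gamma b).
Proof.
have -> : fiber_output gamma b =
    \bigcup_(xy in [set xy : text V T * text V T | f xy.2 = f xy.1])
      ([set xy.1] `*` [set z | gamma (xy.2, z) = b]).
  apply/seteqP; split=> [[x z] [y fy gy]|[x z] [[x' y] /= fxy [/= -> gy]]].
    by exists (x, y).
  by exists y.
apply: fin_bigcup_measurable; first exact: finite_finset.
by move=> xy _; apply: measurableX => //; exact: measurable_detector_section.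
Qed.

Lemma expectation_fiber_output gamma b
    (P : probability (text V T * T.-tuple Z)%type R) :
  ('E_P[fun w : text V T * T.-tuple Z =>
    sup [set ((gamma (y, w.2) == b)%:R : R) | y in fiber f w.1]] =
  P (fiber_output gamma b))%E.
Proof.
rewrite -expectation_indic; last exact: measurable_fiber_output.
congr expectation; apply/funext => w; rewrite sup_bool; last by exists w.1.
rewrite indicE; congr (_%:R); congr nat_of_bool.
apply/idP/idP; rewrite inE.
  by move=> /asboolP [y fy /eqP gy]; exists y.
by move=> [y fy gy]; apply/asboolP; exists y => //; apply/eqP.
Qed.

Lemma beta1E gamma P : beta1 gamma P f = P (fiber_output gamma false).
Proof. exact: expectation_fiber_output. Qed.

Lemma beta0E gamma (Q' : probability (text V T) R)
    (Pz : probability (T.-tuple Z) R) :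
  beta0 gamma Q' Pz f = (Q' \x Pz)%E (fiber_output gamma true).
Proof. exact: expectation_fiber_output. Qed.

Lemma text_law_class P k : fine (P (fst @^-1` [set x | f x = k])) =
  \sum_(x | f x == k) Defs.pmf (text_law P) x.
Proof.
apply/EFin_inj.
rewrite -(probability_pmf (text_law P) [pred x | f x == k]).
rewrite fineK ?fin_num_measure//.
  by congr (P _); apply/seteqP; split => w /= /eqP.
by rewrite -[X in measurable X]setTI; exact: measurable_fst.
Qed.

Lemma excess_le_beta1 gamma P (alpha : R) :
  (forall Q', (beta0 gamma Q' (aux_law P) f <= alpha%:E)%E) -> 0 <= alpha ->
  ((excess alpha f (text_law P))%:E <= beta1 gamma P f)%E.
Proof.
move=> g0 alpha0; rewrite beta1E.
have mf k : measurable ((f \o fst) @^-1` [set k] : set (text V T * T.-tuple Z)).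
  rewrite -[X in measurable X]setTI.
  exact: (measurable_fst _ (f @^-1` [set k])).
(* Splitting the miss event by the class of the observed text reduces the bound to one summand. *)
rewrite (measure_fin_preimage P (g := f \o fst))//; last first.
  exact: measurable_fiber_output.
rewrite -sumEFin; apply: lee_sum => k _.
rewrite EFin_max ge_max measure_ge0 andbT.
rewrite -text_law_class EFinB fineK ?fin_num_measure//; last exact: (mf k).
rewrite leeBlDr//.
(* The point mass needs a text in class [k]; an empty class has mass 0. *)
have [[x0 fx0]|nox] := pselect (exists x, f x = k); last first.
  rewrite [X in P X](_ : _ = set0) ?measure0 ?adde_ge0//.
  by apply/seteqP; split=> // -[x z] /= fx; apply: nox; exists x.
(* The auxiliary sequences for which all of class [k] is accepted. *)
pose B := [set z | forall y, f y = k -> gamma (y, z) = true].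
have mB : measurable B.
  rewrite (_ : B =
    \bigcap_(y in [set y | f y = k]) [set z | gamma (y, z) = true])//.
  apply: fin_bigcap_measurable => [|y _]; first exact: finite_finset.
  exact: measurable_detector_section.
(* Under the point mass at [x0], the false-alarm event contains [[set x0]]*[B]. *)
have BE : (P (snd @^-1` B) <= alpha%:E)%E.
  apply: le_trans (g0 (dirac x0)); rewrite beta0E.
  have -> : P (snd @^-1` B) = (dirac x0 \x aux_law P)%E ([set x0] `*` B).
    by rewrite product_measure1E//= diracE mem_set// mul1e.
  apply: le_measure; rewrite ?inE.
  - exact: measurableX.
  - exact: measurable_fiber_output.
  - by move=> [x z] [/= -> Bz]; exists x0 => //; exact: Bz.
have mB' : measurable (snd @^-1` B : set (text V T * T.-tuple Z)).
  by rewrite -[X in measurable X]setTI; exact: measurable_snd.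
(* On class [k], an auxiliary sequence outside [B] rejects some text of the class, which is a
   miss. *)
apply: (le_trans _ (leeD (lexx _) BE)).
apply: (le_trans _ (measureU2 _ _ _)) => //; last first.
  by apply: measurableI => //; exact: measurable_fiber_output.
apply: le_measure; rewrite ?inE//.
- exact: (mf k).
- apply: measurableU => //; apply: measurableI => //.
  exact: measurable_fiber_output.
- move=> [x z] /= fx; have [Bz|] := pselect (B z); first by right.
  move=> /existsNP[y /not_implyP[fy /negP gy]]; left; split => //.
  by exists y; [rewrite /fiber /= fy|exact/negbTE].
Qed.
End errors.

(** * A scheme attaining the bound for a given text law *)

Section optimal_scheme.
Context (R : realType) (V : finPointedType) (T K : nat) (f : text V T -> 'I_K).
Context (i0 : 'I_T) (alpha : R) (P : probability (text V T) R).
Context (alpha0 : 0 <= alpha).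

Definition class_mass (k : 'I_K) : R := \sum_(x | f x == k) Defs.pmf P x.

(* The conditional probability of leaving class k unmarked, so that its marked
   mass is min(class_mass k, alpha).  At mass 0 the division by 0 gives 0. *)
Definition miss_rate (k : 'I_K) : R :=
  Num.max (class_mass k - alpha) 0 / class_mass k.

Lemma class_mass_ge0 k : 0 <= class_mass k.
Proof. by apply: sumr_ge0 => x _; exact: pmf_ge0. Qed.

Lemma class_mass_miss_rate k :
  class_mass k * miss_rate k = Num.max (class_mass k - alpha) 0.
Proof.
rewrite /miss_rate mulrCA; have [->|k0] := eqVneq (class_mass k) 0; last first.
  by rewrite divff// mulr1.
(* At mass 0 both sides vanish, since [- alpha <= 0]. *)
by rewrite mul0r mulr0 sub0r; apply/esym/max_idPr; rewrite oppr_le0.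
Qed.

Lemma miss_rate_itv k : 0 <= miss_rate k <= 1.
Proof.
have k0 := class_mass_ge0 k.
rewrite /miss_rate divr_ge0 ?le_max ?lexx ?orbT//=.
move: k0; rewrite le_eqVlt => /predU1P[<-|k0]; first by rewrite invr0 mulr0.
by rewrite ler_pdivrMr// mul1r ge_max (ltW k0) andbT gerBl.
Qed.

(** Reading one coordinate suffices: the coupling repeats a single symbol in all of them. *)
Definition match_detector_fun (w : text V T * T.-tuple nat) : bool :=
  tnth w.2 i0 == f w.1.

Lemma measurable_match_detector : measurable_fun setT match_detector_fun.
Proof.
apply: (measurable_fun_bool true); rewrite setTI.
have -> : match_detector_fun @^-1` [set true] =
    \bigcup_(x in [set: text V T])
      ([set x] `*`
       ((fun z : T.-tuple nat => tnth z i0) @^-1` [set (f x : nat)])).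
  apply/seteqP; split=> [[x z] /eqP zx|[x z] [y _ [/= -> zy]]].
    by exists x.
  exact/eqP.
apply: fin_bigcup_measurable => [|x _]; first exact: finite_finset.
apply: measurableX => //; rewrite -[X in measurable X]setTI.
exact: measurable_tnth.
Qed.

HB.instance Definition _ := isMeasurableFun.Build _ _ _ _ match_detector_fun
  measurable_match_detector.

Definition match_detector : detector V T nat := match_detector_fun.

(* The symbol K is not a class index, so it is never matched. *)
Definition coupling_atom (xb : text V T * bool) : text V T * T.-tuple nat :=
  (xb.1, [tuple if xb.2 then f xb.1 : nat else K | i < T]).

(** Joint law of the text and the indicator that it is marked. *)
Definition coupling_weight (xb : text V T * bool) : R :=
  let m := miss_rate (f xb.1) in Defs.pmf P xb.1 * (if xb.2 then 1 - m else m).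

Lemma coupling_weight_ge0 xb : 0 <= coupling_weight xb.
Proof.
have /andP[m0 m1] := miss_rate_itv (f xb.1).
by apply: mulr_ge0; [exact: pmf_ge0|case: ifP; rewrite ?subr_ge0].
Qed.

(** Conditions on the text: each property of the scheme is checked by averaging over the mark
    first. *)
Lemma sum_coupling_weight (g : text V T * bool -> R) :
  \sum_xb coupling_weight xb * g xb =
  \sum_x Defs.pmf P x * ((1 - miss_rate (f x)) * g (x, true) +
                         miss_rate (f x) * g (x, false)).
Proof.
rewrite (eq_bigr (fun xb => coupling_weight (xb.1, xb.2) * g (xb.1, xb.2))).
  rewrite -(pair_bigA _ (fun x b => coupling_weight (x, b) * g (x, b)))/=.
  apply: eq_bigr => x _.
  by rewrite big_bool /= /coupling_weight/= -!mulrA -mulrDr.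
by case.
Qed.

Lemma sum_class (g : 'I_K -> R) :
  \sum_x Defs.pmf P x * g (f x) = \sum_k class_mass k * g k.
Proof.
rewrite (partition_big f predT)//=; apply: eq_bigr => k _.
by rewrite mulr_suml; apply: eq_bigr => x /eqP ->.
Qed.

Lemma optimal_scheme : exists S : scheme R V T nat,
  [/\ forall x, Defs.pmf (text_law S) x = Defs.pmf P x,
      forall Q', (beta0 match_detector Q' (aux_law S) f <= alpha%:E)%E &
      beta1 match_detector S f = (excess alpha f P)%:E].
Proof.
have w1 : \sum_xb coupling_weight xb = 1.
  under eq_bigr do rewrite -[coupling_weight _]mulr1.
  rewrite (sum_coupling_weight (fun=> 1)) -[RHS](pmf_sum1 P).
  by apply: eq_bigr => x _; rewrite /= !mulr1 subrK mulr1.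
have [S SE] := atomic_probability coupling_atom coupling_weight_ge0 w1.
have tnthE x b : tnth (coupling_atom (x, b)).2 i0 = if b then f x : nat else K.
  by rewrite tnth_mktuple.
exists S; split.
- move=> x; rewrite [LHS](_ : _ = fine (S (fst @^-1` [set x])))// SE /=.
  rewrite (sum_coupling_weight
    (fun xb => \1_(fst @^-1` [set x]) (coupling_atom xb))).
  rewrite (bigD1 x)//= big1 ?addr0 => [|y yx].
    by rewrite !indicE !mem_set//= !mulr1 subrK mulr1.
  by rewrite !indicE !memNset ?mulr0 ?addr0 ?mulr0//= => /eqP; exact/negP.
- move=> Q'; rewrite beta0E /product_measure1.
  (* The bound by [alpha] holds for each fixed observed text, hence for every [Q']. *)
  apply: (@le_trans _ _ (\int[Q']_x (cst alpha%:E x))%E); last first.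
    rewrite integral_cst// [X in (_ * X)%E](_ : _ = 1%E) ?mule1//.
    exact: probability_setT.
  apply: ge0_le_integral => //.
  move=> x _; rewrite /= [leLHS](SE (snd @^-1` _)) lee_fin.
  (* The section at [x] has the mass of the marked part of its class. *)
  rewrite (_ : \sum_i _ = class_mass (f x) * (1 - miss_rate (f x))).
    rewrite mulrBr mulr1 class_mass_miss_rate lerBlDr -lerBlDl.
    by rewrite le_max lexx.
  rewrite (sum_coupling_weight (fun xb => \1_(snd @^-1` _) (coupling_atom xb))).
  rewrite mulr_suml [in RHS]big_mkcond; apply: eq_bigr => y _.
  (* A false alarm at [x] needs a marked atom of the same class; the symbol [K] exceeds every class
     index. *)
  have hitE b : \1_(snd @^-1` (xsection (fiber_output f match_detector true) x))
      (coupling_atom (y, b)) = (b && (f y == f x))%:R :> R.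
    rewrite indicE; congr (_%:R); congr nat_of_bool; apply/idP/idP.
      rewrite inE /= /xsection /= inE => -[x' /= fx'].
      rewrite /match_detector_fun /= => /eqP; rewrite tnthE fx'.
      case: b => [/val_inj ->|Kfx]; first by rewrite eqxx.
      by have := ltn_ord (f x); rewrite -Kfx ltnn.
    move=> /andP[b_ /eqP yx]; rewrite inE /= /xsection /= inE; exists x => //.
    by rewrite /= /match_detector_fun /= tnthE b_ yx eqxx.
  rewrite !hitE /= mulr0 addr0.
  by case: eqP => [->|_]; rewrite ?mulr1// !mulr0.
- rewrite beta1E SE; congr EFin.
  rewrite (sum_coupling_weight (fun xb => \1_(_) (coupling_atom xb))).
  rewrite /excess; under [RHS]eq_bigr do rewrite -class_mass_miss_rate.
  rewrite -sum_class; apply: eq_bigr => y _.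
  (* Substitutes keep the class, so a miss occurs exactly on the unmarked atoms. *)
  have missE b : \1_(fiber_output f match_detector false)
      (coupling_atom (y, b)) = (~~ b)%:R :> R.
    rewrite indicE; congr (_%:R); congr nat_of_bool; apply/idP/idP.
      rewrite inE => -[x' /= fx'].
      by rewrite /match_detector_fun /= tnthE fx'; case: b => //; rewrite eqxx.
    move=> /negbTE ->; rewrite inE; exists y => //.
    apply/negbTE; rewrite [X in ~~ X](_ : _ = (K == f y :> nat)).
      by rewrite neq_ltn ltn_ord orbT.
    by congr (_ == _); exact: (tnthE y false).
  by rewrite !missE /= mulr0 add0r mulr1.
Qed.
End optimal_scheme.

(** * Existence of the minimum by compactness *)

(** The ball is a nonempty closed subset of the unit cube, compact by Tychonoff, so the continuous
    [F] attains its minimum there. *)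
Lemma simplex_tv_min (R : realType) (I : finType)
    (F : prod_topology (fun _ : I => R : topologicalType) -> R)
    (q : I -> R) (epsilon : R) :
  continuous F -> 0 <= epsilon -> (forall x, 0 <= q x) -> \sum_x q x = 1 ->
  exists p : I -> R, [/\ (forall x, 0 <= p x), \sum_x p x = 1,
    2^-1 * \sum_x `|p x - q x| <= epsilon &
    forall p', (forall x, 0 <= p' x) -> \sum_x p' x = 1 ->
      2^-1 * \sum_x `|p' x - q x| <= epsilon -> F p <= F p'].
Proof.
move=> cF e0 q0 q1.
pose S : topologicalType := prod_topology (fun _ : I => R : topologicalType).
have cproj (x : I) : continuous (fun p : S => p x).
  exact: (@proj_continuous I (fun _ => R : topologicalType) x).
have csum : continuous (fun p : S => \sum_x p x).
  by apply: continuous_big => [|x _]; [exact: add_continuous|exact: cproj].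
have ctv : continuous (fun p : S => 2^-1 * \sum_x `|p x - q x|).
  move=> p.
  apply: (@cvgMl_tmp R S (nbhs p) _ (fun p : S => \sum_x `|p x - q x|)).
  move: p; apply: continuous_big => [|x _ p]; first exact: add_continuous.
  apply: (@cvg_norm R R S (nbhs p) _ (fun p : S => p x - q x) (p x - q x)).
  apply: (@cvgB R R S (nbhs p) _ (fun p : S => p x) (fun=> q x)).
    exact: cproj.
  exact: cvg_cst.
pose cube : set S := [set p | forall x, `[0, 1]%classic (p x)].
pose A : set S := cube `&`
  ([set p | \sum_x p x = 1] `&`
   [set p | 2^-1 * \sum_x `|p x - q x| <= epsilon]).
(* Nonnegative masses with sum 1 lie in [0, 1], so the cube excludes no probability vector. *)
have AE (p : S) : A p <-> [/\ (forall x, 0 <= p x), \sum_x p x = 1 &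
    2^-1 * \sum_x `|p x - q x| <= epsilon].
  split=> [[p01 [p1 pq]]|[p0 p1 pq]].
    by split=> // x; have := p01 x; rewrite /= in_itv => /andP[].
  split=> // x; rewrite /= in_itv /= p0 -p1 (bigD1 x)//= lerDl.
  exact: sumr_ge0.
(* The centre [q] is at distance 0 from itself. *)
have A0 : A !=set0.
  exists q; apply/AE; split => //.
  by rewrite big1 ?mulr0// => x _; rewrite subrr normr0.
have ccube : compact cube.
  apply: (@tychonoff I (fun _ => R : topologicalType)
    (fun _ => `[0, 1]%classic)) => _.
  exact: segment_compact.
have clA : closed A.
  apply: closedI.
    apply: compact_closed ccube.
    by apply: hausdorff_product => _; exact: norm_hausdorff.
  apply: closedI.
    apply: (@closed_comp S R (fun p => \sum_x p x) [set y | y = 1]).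
      by move=> p _; exact: csum.
    exact: closed_eq.
  apply: (@closed_comp S R (fun p => 2^-1 * \sum_x `|p x - q x|)
    [set y | y <= epsilon]); last exact: closed_le.
  by move=> p _; exact: ctv.
have cA : compact A by apply: (subclosed_compact clA ccube) => p [].
have [p] := compact_EVT_min A0 cA (continuous_subspaceT cF).
rewrite inE => /AE[p0 p1 pq] pmin; exists p; split => // p' p'0 p'1 p'q.
by apply: (pmin p'); rewrite inE; apply/AE.
Qed.

Lemma excess_min (R : realType) (V : finPointedType) (T K : nat)
    (f : text V T -> 'I_K) (Q : probability (text V T) R) (alpha epsilon : R) :
  0 <= epsilon -> exists2 P, tv_ball Q epsilon P &
    forall P', tv_ball Q epsilon P' -> excess alpha f P <= excess alpha f P'.
Proof.
move=> e0.
pose S : topologicalType :=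
  prod_topology (fun _ : text V T => R : topologicalType).
(* Extends [excess] from mass functions to all real vectors, where continuity can be stated. *)
pose F (p : S) : R :=
  \sum_(k < K) Num.max (\sum_(x | f x == k) p x - alpha) 0.
have cF : continuous F.
  apply: continuous_big => [|k _ p]; first exact: add_continuous.
  apply: (@continuous_max R S
    (fun p => \sum_(x | f x == k) p x - alpha) (fun=> 0)); last first.
    exact: (@cst_continuous S R 0).
  apply: (@cvgB R R S (nbhs p) _
    (fun p : S => \sum_(x | f x == k) p x) (fun=> alpha)); last exact: cvg_cst.
  move: p; apply: continuous_big => [|x _]; first exact: add_continuous.
  exact: (@proj_continuous (text V T) (fun _ => R : topologicalType) x).
have [p [p0 p1 pQ pmin]] := simplex_tv_min cF e0 (pmf_ge0 Q) (pmf_sum1 Q).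
have [P PE] := atomic_probability (X := text V T) id p0 p1.
have pE : p = Defs.pmf P.
  apply/funext => x; rewrite /Defs.pmf PE /= (bigD1 x)//= big1 => [|y yx].
    by rewrite addr0 indicE mem_set//= mulr1.
  by rewrite indicE memNset ?mulr0//= => /eqP; exact/negP.
rewrite {}pE in p0 p1 pQ pmin.
by exists P => // P' P'Q; apply: pmin => //; [exact: pmf_ge0|exact: pmf_sum1].
Qed.

(** * The optimal error equals the minimal excess *)

Theorem theorem6 (R : realType) (V : finPointedType) (T K : nat)
    (hT : (1 <= T)%N) (hK : (1 <= K)%N) (f : text V T -> 'I_K)
    (Q : probability (text V T) R) (alpha epsilon : R)
    (halpha : 0 < alpha < 1) (hepsilon : 0 <= epsilon) :
  exists P : probability (text V T) R,
    [/\ tv_ball Q epsilon P,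
        forall P' : probability (text V T) R,
          tv_ball Q epsilon P' -> excess alpha f P <= excess alpha f P' &
        opt_beta1 Q alpha epsilon f = (excess alpha f P)%:E].
Proof.
have [P PQ Pmin] := excess_min f Q alpha hepsilon.
have alpha0 : 0 <= alpha by case/andP: halpha => /ltW.
exists P; split => //; apply/eqP; rewrite eq_le; apply/andP; split.
  (* Since [1 <= T], coordinate 0 exists and can carry the mark. *)
  have [S [SP S0 S1]] := optimal_scheme f (Ordinal hT) P alpha0.
  apply: ereal_inf_lbound; exists _, nat, (match_detector f (Ordinal hT)), S.
  split; last by rewrite S1.
  split; first by apply: ge_ereal_sup => _ [Q' _ <-]; exact: S0.
  by rewrite /tv_dist; under eq_bigr do rewrite SP.
(* The text law of any feasible scheme lies in the ball, so its excess is at least the minimum. *)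
apply: le_ereal_inf_tmp => _ [d [Z [gamma [S [[S0 SQ] ->]]]]].
apply: le_trans (excess_le_beta1 (alpha := alpha) _ alpha0).
  by rewrite lee_fin; exact: Pmin.
by move=> Q'; apply: le_trans S0; apply: ereal_sup_ubound; exists Q'.
Qed.
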